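(* For every integer $k\ge 1$, the following identity of formal power series holds: \[ \sum_{x_1,\dots,x_k,m,n\ge 0}\overline{S}(x_1,\dots,x_k;m,n)\,y_1^{x_1}\cdots y_k^{x_k}d^mq^n=\frac{(-y_1q;q)_\infty(-y_2q;q)_\infty\cdots(-y_kq;q)_\infty}{(y_1dq;q)_\infty}, \] where $\overline{S}(x_1,\dots,x_k;m,n)$ is the number of colored overpartitions defined in the context.
   Context: $\mathbb N=\{0,1,2,\dots\}$ and $(a;q)_\infty=\prod_{r\ge 0}(1-aq^r)$. An overpartition of $n$ is an integer partition $\lambda=(\lambda_1\ge\dots\ge\lambda_L)$ of $n$ (positive parts; the empty partition is the only partition of $0$) in which the first occurrence of each value may or may not be overlined. A colored overpartition also assigns to each part $\lambda_i$ a color $c_i$; it is thus a finite sequence of parts, each with a value, a color and an overlined/non-overlined status. For a positive integer $c$ (a color), let $\omega(c)$ be the number of ones in the binary representation of $c$ (the number of distinct powers of $2$ summing to $c$), and let $v(c)$ and $z(c)$ be respectively the smallest and the largest power of $2$ occurring in the binary representation of $c$. Set $\delta(c,c')=1$ if $z(c)<v(c')$, and $\delta(c,c')=0$ otherwise. For $x_1,\dots,x_k,m,n\in\mathbb N$, $\overline S(x_1,\dots,x_k;m,n)$ is the number of overpartitions $\lambda=(\lambda_1,\dots,\lambda_L)$ of $n$ in $2^k-1$ colors, i.e. with colors $c_1,\dots,c_L\in\{1,\dots,2^k-1\}$, having exactly $m$ non-overlined parts and satisfying: (i) the smallest part satisfies $\lambda_L\ge\omega(c_L)$; (ii) for each $i=1,\dots,k$,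 exactly $x_i$ parts have $2^{i-1}$ in the binary representation of their color; (iii) $\lambda_i-\lambda_{i+1}\ge\omega(c_i)+\delta(c_i,c_{i+1})-\mathbf 1_{\lambda_{i+1}\text{ is not overlined}}$ for $i=1,\dots,L-1$; (iv) the $s$ smallest parts (the last $s$ parts of the sequence) are overlined, where $s=\sum_{r=1}^{k-1}V_{2^r}$ and $V_{2^r}$ is the number of parts $\lambda_i$ with $v(c_i)=2^r$. (For the empty overpartition all conditions on parts are vacuous.) *)

(* Defs.v *)
From HB Require Import structures.
From mathcomp Require Import all_boot all_order all_algebra.
From mathcomp Require boolp.
From mathcomp Require Import mpoly.

Set Implicit Arguments.
Unset Strict Implicit.
Unset Printing Implicit Defensive.

Import GRing.Theory.
Local Open Scope ring_scope.

(* Formal power series in n variables over R, given by their coefficients;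
   monomials are the multinomials 'X_{1..n} of the multinomials library. *)

Record fps (R : Type) (n : nat) := Fps { fps_coef :> 'X_{1..n} -> R }.

HB.instance Definition _ (R : Type) (n : nat) :=
  boolp.gen_eqMixin (fps R n).
HB.instance Definition _ (R : Type) (n : nat) :=
  boolp.gen_choiceMixin (fps R n).

Lemma fpsP (R : Type) (n : nat) (f g : fps R n) : f =1 g <-> f = g.
Proof.
split=> [|-> //]; case: f g => f [g] /= fg.
by congr Fps; apply: boolp.funext.
Qed.

Section FpsRing.
Variables (R : comNzRingType) (n : nat).
Implicit Types (f g h : fps R n) (m : 'X_{1..n}).

Definition fps0 : fps R n := Fps (fun=> 0).
Definition fps1 : fps R n := Fps (fun m => (m == 0%MM)%:R).
Definition fps_add f g : fps R n := Fps (fun m => f m + g m).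
Definition fps_opp f : fps R n := Fps (fun m => - f m).

(* The bound on the degrees only serves to make the index type finite. *)
Definition fps_mul f g : fps R n :=
  Fps (fun m =>
    \sum_(k : 'X_{1..n < (mdeg m).+1, (mdeg m).+1} | m == (k.1 + k.2)%MM)
       f k.1 * g k.2).

Fact fps_addA : associative fps_add.
Proof. by move=> f g h; apply/fpsP => m /=; rewrite addrA. Qed.

Fact fps_addC : commutative fps_add.
Proof. by move=> f g; apply/fpsP => m /=; rewrite addrC. Qed.

Fact fps_add0 : left_id fps0 fps_add.
Proof. by move=> f; apply/fpsP => m /=; rewrite add0r. Qed.

Fact fps_addN : left_inverse fps0 fps_opp fps_add.
Proof. by move=> f; apply/fpsP => m /=; rewrite addNr. Qed.

HB.instance Definition _ :=
  GRing.isZmodule.Build (fps R n) fps_addA fps_addC fps_add0 fps_addN.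

Definition fps_trunc b f : {mpoly R[n]} :=
  \sum_(m : 'X_{1..n < b}) f m *: 'X_[m].

Lemma mcoeff_fps_trunc b f m : (mdeg m < b)%N -> (fps_trunc b f)@_m = f m.
Proof. exact: mcoeff_mpoly. Qed.

Lemma fps_mulE b f g m :
  (mdeg m < b)%N -> fps_mul f g m = (fps_trunc b f * fps_trunc b g)@_m.
Proof.
move=> lt_mb; rewrite (mcoeff_poly_mul _ _ (ltnSn (mdeg m))) /=.
apply: eq_bigr => k _.
by rewrite !mcoeff_fps_trunc //; apply: leq_trans (bmdeg _) _.
Qed.

Lemma eq_mcoeff_mul b (p p' r r' : {mpoly R[n]}) m :
    (mdeg m < b)%N ->
    (forall m', (mdeg m' < b)%N -> p@_m' = p'@_m') ->
    (forall m', (mdeg m' < b)%N -> r@_m' = r'@_m') ->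
  (p * r)@_m = (p' * r')@_m.
Proof.
move=> lt_mb eq_p eq_r; rewrite !(mcoeff_poly_mul _ _ lt_mb).
by apply: eq_bigr => k _; rewrite eq_p ?eq_r ?bmdeg.
Qed.

Lemma mcoeff_fps_trunc_mul b f g m :
  (mdeg m < b)%N ->
  (fps_trunc b (fps_mul f g))@_m = (fps_trunc b f * fps_trunc b g)@_m.
Proof. by move=> lt_mb; rewrite mcoeff_fps_trunc // (fps_mulE _ _ lt_mb). Qed.

Fact fps_mulA : associative fps_mul.
Proof.
move=> f g h; apply/fpsP => m; have lt_m := ltnSn (mdeg m).
rewrite !(fps_mulE _ _ lt_m).
rewrite [LHS](eq_mcoeff_mul lt_m (p' := fps_trunc (mdeg m).+1 f)
  (r' := fps_trunc (mdeg m).+1 g * fps_trunc (mdeg m).+1 h)) //.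
  rewrite mulrA; apply: (eq_mcoeff_mul lt_m) => // m' lt_m'.
  by rewrite mcoeff_fps_trunc_mul.
by move=> m' lt_m'; rewrite mcoeff_fps_trunc_mul.
Qed.

Fact fps_mulC : commutative fps_mul.
Proof.
move=> f g; apply/fpsP => m; have lt_m := ltnSn (mdeg m).
by rewrite !(fps_mulE _ _ lt_m) mulrC.
Qed.

Fact fps_mul1 : left_id fps1 fps_mul.
Proof.
move=> f; apply/fpsP => m; have lt_m := ltnSn (mdeg m).
rewrite (fps_mulE _ _ lt_m) (eq_mcoeff_mul lt_m (p' := 1)
  (r' := fps_trunc (mdeg m).+1 f)) //.
  by rewrite mul1r mcoeff_fps_trunc.
by move=> m' lt_m'; rewrite mcoeff_fps_trunc //= mcoeff1.
Qed.

Fact fps_mulDl : left_distributive fps_mul fps_add.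
Proof.
move=> f g h; apply/fpsP => m /=; rewrite -big_split /=.
by apply: eq_bigr => k _; rewrite mulrDl.
Qed.

Fact fps_oner_neq0 : fps1 != 0.
Proof.
apply/eqP => /fpsP/(_ 0%MM) /= /eqP.
by rewrite eqxx oner_eq0.
Qed.

HB.instance Definition _ := GRing.Zmodule_isComNzRing.Build (fps R n)
  fps_mulA fps_mulC fps_mul1 fps_mulDl fps_oner_neq0.

Lemma fps_coef0 m : (0 : fps R n) m = 0. Proof. by []. Qed.
Lemma fps_coef1 m : (1 : fps R n) m = (m == 0%MM)%:R. Proof. by []. Qed.
Lemma fps_coefD f g m : (f + g) m = f m + g m. Proof. by []. Qed.
Lemma fps_coefN f m : (- f) m = - f m. Proof. by []. Qed.
Lemma fps_coefM f g m :
  (f * g) m =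
  \sum_(k : 'X_{1..n < (mdeg m).+1, (mdeg m).+1} | m == (k.1 + k.2)%MM)
     f k.1 * g k.2.
Proof. by []. Qed.

Lemma fps_coef_sum (I : Type) (r : seq I) (P : pred I) (F : I -> fps R n) m :
  (\sum_(i <- r | P i) F i) m = \sum_(i <- r | P i) F i m.
Proof. by elim/big_rec2: _ => // i x y _ <-. Qed.

Lemma fps_coef0M f g : (f * g) 0%MM = f 0%MM * g 0%MM.
Proof.
have lt0 : (mdeg (0%MM : 'X_{1..n}) < 1)%N by rewrite mdeg0.
have -> : (f * g) 0%MM = (fps_trunc 1 f * fps_trunc 1 g)@_0%MM.
  exact: fps_mulE.
by rewrite rmorphM /= !mcoeff_fps_trunc.
Qed.

Definition fpsX (i : 'I_n) : fps R n := Fps (fun m => (m == U_(i)%MM)%:R).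

Lemma fps_coefM_eq0 f g b c :
    (forall m, (mdeg m < b)%N -> f m = 0) ->
    (forall m, (mdeg m < c)%N -> g m = 0) ->
  forall m, (mdeg m < b + c)%N -> (f * g) m = 0.
Proof.
move=> f0 g0 m lt_m; rewrite fps_coefM big1 // => k /eqP def_m.
have [lt_b | le_b] := ltnP (mdeg k.1) b; first by rewrite f0 ?mul0r.
have [lt_c | le_c] := ltnP (mdeg k.2) c; first by rewrite g0 ?mulr0.
have := leq_add le_b le_c.
by rewrite -mdegD -def_m leqNgt lt_m.
Qed.

Lemma fps_coefX_eq0 f r m : f 0%MM = 0 -> (mdeg m < r)%N -> (f ^+ r) m = 0.
Proof.
move=> f0; elim: r m => // r IHr m lt_m; rewrite exprS.
apply: (fps_coefM_eq0 (b := 1) (c := r)) => //.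
by move=> m'; rewrite ltnS leqn0 mdeg_eq0 => /eqP ->.
Qed.

End FpsRing.

Section FpsUnit.
Variables (R : comUnitRingType) (n : nat).
Implicit Types (f g h : fps R n) (m : 'X_{1..n}).

Definition fps_unit : {pred fps R n} := fun f => f 0%MM \is a GRing.unit.

(* If f has an invertible constant coefficient c, then f^-1 is the geometric
   series of 1 - f / c, divided by c; the terms of exponent larger than the
   degree of m do not contribute to the coefficient of m. *)
Definition fps_inv f : fps R n :=
  if f \in fps_unit then
    let h := Fps (fun m => (m == 0%MM)%:R - (f 0%MM)^-1 * f m) in
    Fps (fun m => (f 0%MM)^-1 * (\sum_(j < (mdeg m).+1) h ^+ j) m)
  else f.

Fact fps_mulVf : {in fps_unit, left_inverse 1 fps_inv *%R}.
Proof.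
move=> f uf; rewrite /fps_inv uf; set c := f 0%MM.
pose h := Fps (fun m => (m == 0%MM)%:R - c^-1 * f m); rewrite -/h.
have uc : c \is a GRing.unit by [].
have h0 : h 0%MM = 0.
  by rewrite /h /= eqxx mulVr ?subrr.
have sumE b m : (mdeg m < b)%N ->
    (\sum_(j < (mdeg m).+1) h ^+ j) m = (\sum_(j < b) h ^+ j) m.
  move=> lt_m; rewrite !fps_coef_sum (big_ord_widen _ (fun j => (h ^+ j) m) lt_m).
  rewrite big_mkcond /=; apply: eq_bigr => j _; case: ifP => // /negbT.
  by rewrite -leqNgt => lt_j; rewrite fps_coefX_eq0.
apply/fpsP => m; rewrite fps_coefM.
pose b := (mdeg m).+1.
transitivity (((\sum_(j < b) h ^+ j) * (1 - h)) m).
  rewrite fps_coefM; apply: eq_bigr => k /eqP def_m.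
  rewrite [LHS]/= (@sumE b) ?bmdeg // mulrAC mulrC; congr (_ * _).
  by rewrite fps_coefD fps_coefN fps_coef1 /= opprB addrC subrK.
have -> : (\sum_(j < b) h ^+ j) * (1 - h) = 1 - h ^+ b.
  rewrite mulrC -{2}(expr1n _ b) subrXX; congr (_ * _).
  by apply: eq_bigr => j _; rewrite expr1n mul1r.
by rewrite fps_coefD fps_coefN (fps_coefX_eq0 h0) // subr0.
Qed.

Fact fps_unitPl f g : g * f = 1 -> f \in fps_unit.
Proof.
move=> /(congr1 (fun h : fps R n => h 0%MM)).
rewrite fps_coef0M fps_coef1 eqxx => gf1.
by apply/unitrPr; exists (g 0%MM); rewrite mulrC.
Qed.

Fact fps_invr_out : {in [predC fps_unit], fps_inv =1 id}.
Proof. by move=> f; rewrite inE /fps_inv => /negbTE ->. Qed.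

HB.instance Definition _ := GRing.ComNzRing_hasMulInverse.Build (fps R n)
  fps_mulVf fps_unitPl fps_invr_out.

Lemma fps_unitE f : (f \is a GRing.unit) = (f 0%MM \is a GRing.unit).
Proof. by []. Qed.

End FpsUnit.

Section QPochhammer.
Variables (R : comNzRingType) (n : nat).
Implicit Types (a q : fps R n) (m : 'X_{1..n}).

(* The infinite product prod_(r >= 0) (1 - a q^r), for a series q without
   constant term: the factors of index r > mdeg m do not contribute to the
   coefficient of m, see qpoch_infE. *)
Definition qpoch_inf a q : fps R n :=
  Fps (fun m => (\prod_(r < (mdeg m).+1) (1 - a * q ^+ r)) m).

Lemma qpoch_infE a q m N : q 0%MM = 0 -> (mdeg m < N)%N ->
  qpoch_inf a q m = (\prod_(r < N) (1 - a * q ^+ r)) m.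
Proof.
move=> q0; elim: N => // N IHN; rewrite ltnS leq_eqVlt.
case/predU1P => [<- // | lt_m]; rewrite IHN //.
set P := \prod_(r < N) _.
have -> : \prod_(r < N.+1) (1 - a * q ^+ r) = P - (P * a) * q ^+ N.
  rewrite big_ord_recr -[LHS]/(P * (1 - a * q ^+ N)).
  by rewrite mulrBr mulr1 mulrA.
rewrite fps_coefD fps_coefN.
rewrite (fps_coefM_eq0 (b := 0) (c := N)) ?subr0 //.
by move=> m' lt_m'; rewrite fps_coefX_eq0.
Qed.

Lemma qpoch_inf_coef0 a q : q 0%MM = 0 ->
  qpoch_inf a q 0%MM = 1 - a 0%MM.
Proof.
move=> q0; rewrite (@qpoch_infE _ _ _ 1) ?mdeg0 // big_ord1 expr0 mulr1.
by rewrite fps_coefD fps_coefN fps_coef1 eqxx.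
Qed.

End QPochhammer.

Local Open Scope nat_scope.

(* The distinct powers of 2 with sum c, in increasing order. *)
Definition bin_powers (c : nat) : seq nat :=
  [seq 2 ^ i | i <- iota 0 c & odd (c %/ 2 ^ i)].

Definition omega (c : nat) : nat := size (bin_powers c).
Definition vmin (c : nat) : nat := head 0 (bin_powers c).
Definition zmax (c : nat) : nat := last 0 (bin_powers c).
Definition delta (c c' : nat) : nat := zmax c < vmin c'.

Lemma sorted_bin_powers c : sorted ltn (bin_powers c).
Proof.
rewrite /bin_powers sorted_map; apply: sorted_filter.
  by move=> y x z /=; apply: ltn_trans.
apply: sub_sorted (iota_ltn_sorted 0 c) => i j /= lt_ij.
by rewrite ltn_exp2l.
Qed.

Lemma sumn_bin_powers c : sumn (bin_powers c) = c.
Proof.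
rewrite /bin_powers sumnE big_map big_filter.
have sumE N x : \sum_(i <- iota 0 N | odd (x %/ 2 ^ i)) 2 ^ i = x %% 2 ^ N.
  elim: N => [|N IHN]; first by rewrite big_nil modn1.
  rewrite -addn1 iotaD big_cat /= IHN big_cons big_nil add0n addn1.
  set a := x %/ 2 ^ N; set b := x %% 2 ^ N.
  have def_x : x = a./2 * 2 ^ N.+1 + (odd a * 2 ^ N + b).
    rewrite {1}(divn_eq x (2 ^ N)) -/a -/b -{1}(odd_double_half a).
    by rewrite mulnDl -muln2 -mulnA -expnS addnA [X in X + b]addnC.
  have lt_b : b < 2 ^ N by rewrite ltn_mod expn_gt0.
  rewrite [in RHS]def_x modnMDl modn_small.
    by case: (odd a); rewrite ?mul1n ?addn0 // addnC.
  rewrite expnS mul2n -addnn -addnS leq_add //.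
  by case: (odd a); rewrite ?mul1n.
by rewrite sumE modn_small // ltn_expl.
Qed.

(* A part: value, color, and whether it is overlined. *)
Definition part : Type := nat * nat * bool.
Definition pval (p : part) : nat := p.1.1.
Definition pcol (p : part) : nat := p.1.2.
Definition pover (p : part) : bool := p.2.

Definition is_colored_overpartition (C n : nat) (l : seq part) : bool :=
  [&& sorted geq (map pval l),
      all (fun p => 0 < pval p) l,
      sumn (map pval l) == n,
      sorted (fun p p' => (pval p == pval p') ==> ~~ pover p') l
    & all (fun p => 1 <= pcol p <= C) l].

Definition cond_smallest (l : seq part) : bool :=
  if l is p :: l' then omega (pcol (last p l')) <= pval (last p l') else true.

Definition cond_colors (k : nat) (x : 'I_k -> nat) (l : seq part) : bool :=
  [forall i : 'I_k, count (fun p => 2 ^ i \in bin_powers (pcol p)) l == x i].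

(* The subtracted terms are moved across, to avoid truncated subtraction. *)
Definition cond_diff (l : seq part) : bool :=
  sorted (fun p p' => pval p' + omega (pcol p) + delta (pcol p) (pcol p')
                      <= pval p + ~~ pover p') l.

Definition cond_overlined (k : nat) (l : seq part) : bool :=
  let s := \sum_(1 <= r < k) count (fun p => vmin (pcol p) == 2 ^ r) l in
  all pover (drop (size l - s) l).

Definition is_counted (k : nat) (x : 'I_k -> nat) (m n : nat) (l : seq part) :
    bool :=
  [&& is_colored_overpartition (2 ^ k - 1) n l,
      count (fun p => ~~ pover p) l == m,
      cond_smallest l, cond_colors x l, cond_diff l & cond_overlined k l].

(* Overpartitions of n have at most n parts, each with value at most n, so
   they can be counted inside a finite type, see card_is_counted. *)
Definition bpart (k n : nat) : finType := ('I_n.+1 * 'I_(2 ^ k) * bool)%type.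

Definition part_of (k n : nat) (p : bpart k n) : part :=
  (val p.1.1, val p.1.2, p.2).

Definition Sbar (k : nat) (x : 'I_k -> nat) (m n : nat) : nat :=
  #|[set l : n.-bseq (bpart k n) | is_counted x m n (map (@part_of k n) l)]|.

Lemma card_is_counted (k : nat) (x : 'I_k -> nat) (m n : nat)
    (s : seq (seq part)) :
  uniq s -> (forall l, (l \in s) = is_counted x m n l) -> size s = Sbar x m n.
Proof.
move=> uniq_s s_l; rewrite /Sbar cardE.
have part_inj : injective (@part_of k n).
  by case=> [[v c] o] [[v' c'] o'] [] /val_inj-> /val_inj-> ->.
set t := enum _; rewrite -(size_map (fun l : n.-bseq _ => map (@part_of k n) l) t).
apply/perm_size/uniq_perm => //.
  rewrite map_inj_uniq ?enum_uniq // => l1 l2 /(inj_map part_inj).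
  exact: val_inj.
move=> l; rewrite s_l; apply/idP/mapP => [cl | [l' + ->]]; last first.
  by rewrite mem_enum inE.
have [/and5P[_ pos_l /eqP sum_l _ /allP col_l] _] := andP cl.
have val_le p : p \in l -> pval p < n.+1.
  by move=> lp; rewrite ltnS -sum_l sumnE big_map (big_rem p) //= leq_addr.
have col_lt p : p \in l -> pcol p < 2 ^ k.
  move=> /col_l /andP[_ le_p]; apply: leq_ltn_trans le_p _.
  by rewrite subn1 prednK ?leqnn // expn_gt0.
pose tob (p : part) : bpart k n :=
  (inord (pval p), insubd (Ordinal (expn_gt0 2 k : 0 < 2 ^ k)) (pcol p), pover p).
have tobK : map (@part_of k n) (map tob l) = l.
  rewrite -map_comp -[RHS]map_id; apply/eq_in_map => -[[v c] o] lp.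
  have /= lt_v := val_le _ lp; have /= lt_c := col_lt _ lp.
  by rewrite /part_of /tob /= inordK // val_insubd lt_c.
have size_l : size (map tob l) <= n.
  rewrite size_map -sum_l sumnE big_map -sum1_size big_seq [leqRHS]big_seq.
  by apply: leq_sum => p /(allP pos_l).
by exists (Bseq size_l); rewrite ?mem_enum ?inE /= tobK.
Qed.

(* The k + 2 variables are y_1, .., y_k, d, q, in this order. *)
Section Series.
Variable k : nat.

Definition yvar (i : 'I_k) : 'I_(k + 2) := lshift 2 i.
Definition dvar : 'I_(k + 2) := rshift k ord0.
Definition qvar : 'I_(k + 2) := rshift k ord_max.

Definition Sbar_series : fps int (k + 2) :=
  Fps (fun e => (Sbar (fun i => e (yvar i)) (e dvar) (e qvar))%:Z%R).

Definition y (i : 'I_k) : fps int (k + 2) := fpsX int (yvar i).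
Definition d : fps int (k + 2) := fpsX int dvar.
Definition q : fps int (k + 2) := fpsX int qvar.

Lemma q_coef0 : q 0%MM = 0%R.
Proof. by rewrite /q /fpsX /= eq_sym mnm1_eq0. Qed.

Lemma qpoch_inf_unit (a : fps int (k + 2)) :
  (qpoch_inf (a * q) q \is a GRing.unit)%R.
Proof.
by rewrite fps_unitE qpoch_inf_coef0 ?q_coef0 // fps_coef0M q_coef0 mulr0 subr0.
Qed.

End Series.

(* Main.v *)
Require Import Defs.
From mathcomp Require Import all_boot all_order all_algebra.
From mathcomp Require Import mpoly zify ring.

(** The colors and overlines of a colored overpartition with L parts form its
    pattern. The difference conditions bound the values from below, part by
    part starting from the smallest, so they say that the values are the sum
    of a minimal vector, which depends on the pattern alone (minvals), and of
    an arbitrary partition into at most L parts (cond_build). Every other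
    condition concerns the pattern only. Bounding the partition part by n - L
    replaces the series 1 / (q;q)_L by the Gaussian binomial [n, L]; for n
    larger than the degree of a monomial this leaves its coefficient unchanged
    (mem_counted_lists). Hence it is enough to evaluate, for each n, the sum of
    [n, L] times the weights of the patterns of length L.

    When all the parts are overlined, the weight of the colors c_1, .., c_L is
    q^W with W the sum of i (omega(c_i) + delta(c_i, c_(i+1))), and the sum over
    colors is exactly the product of the 1 + y_i q^r for i <= k and
    1 <= r <= n (sum_words_qbin). To see this, extend words by a new smallest
    part and allow its color b to range over b < 2^j only. Writing b as 2^j + b'
    shows that passing from j to j + 1 multiplies the generating function by
    1 + y_(j+1) q^(n+1) (low_totalS), and k such steps lead from n to n + 1.

    The i-th largest part not being overlined lowers the i - 1 larger parts by
    one, so it changes the weight by d q^(-(i-1)). Condition (iv) says that only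
    the a largest parts may be non-overlined, where a is the number of parts of
    odd color, that is, the exponent of y_1. Thus overlining multiplies the
    coefficient of y_1^a by the product of the 1 + d q^(-i) for i < a
    (sum_tail_overlined). In the product found above this coefficient is
    q^(a(a+1)/2) [n, a] times the factors of y_2, .., y_k. The powers of q
    cancel, and what remains is the sum over a of [n, a] (y_1 q)^a times the
    product of the q^i + d for i < a (sum_pattern_sums).

    By the q-binomial theorem this last sum H(u), for u = y_1 q, tends to
    (-u;q)_oo / (u d;q)_oo. Concretely, (1 - u d) H(u) and (1 + u) H(u q) agree
    up to degree n (over_sum_shift), and one iterates. *)

Set Implicit Arguments.
Unset Strict Implicit.
Unset Printing Implicit Defensive.

Import GRing.Theory.
Local Open Scope nat_scope.

(** * Binary digits of colors *)

(** The digits can be read off any range of positions long enough to contain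
    them all, which lets two numbers be compared position by position. *)
Lemma bin_powersE N c : c < 2 ^ N ->
  bin_powers c = [seq 2 ^ i | i <- iota 0 N & odd (c %/ 2 ^ i)].
Proof.
have ext n m : c < 2 ^ n ->
    [seq i <- iota 0 (n + m) | odd (c %/ 2 ^ i)]
    = [seq i <- iota 0 n | odd (c %/ 2 ^ i)].
  move=> lt_c; rewrite iotaD filter_cat add0n -[RHS]cats0; congr (_ ++ _).
  apply/eqP; rewrite -[_ == _]negbK -has_filter -all_predC.
  apply/allP => i; rewrite mem_iota => /andP[le_ni _] /=.
  by rewrite divn_small //; apply: leq_trans lt_c _; rewrite leq_exp2l.
move=> lt_c; rewrite /bin_powers; congr map.
have lt_cc : c < 2 ^ c by apply: ltn_expl.
by rewrite -(ext c N) // addnC ext.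
Qed.

(** Adding a new highest digit 2 ^ j is the step on which the recursion over
    colors rests: the lower digits stay, and so does vmin unless b = 0. *)
Lemma bin_powers_top j b : b < 2 ^ j ->
  bin_powers (2 ^ j + b) = rcons (bin_powers b) (2 ^ j).
Proof.
move=> lt_b; have lt_jb : 2 ^ j + b < 2 ^ j.+1.
  by rewrite expnS mul2n -addnn ltn_add2l.
rewrite (bin_powersE lt_jb) (bin_powersE lt_b) -[j.+1]addn1.
rewrite iotaD filter_cat map_cat /=.
rewrite add0n divnDl // divnn expn_gt0 (divn_small lt_b) /= cats1.
congr (rcons (map _ _) _); apply: eq_in_filter => i; rewrite mem_iota => /andP[_].
rewrite add0n => lt_ij; rewrite -(subnK (ltnW lt_ij)) expnD divnDl ?dvdn_mull //.
by rewrite mulnK ?expn_gt0 // oddD oddX subn_eq0 leqNgt lt_ij.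
Qed.

Lemma pow2_split b : 0 < b -> exists j b', [/\ b' < 2 ^ j & b = 2 ^ j + b'].
Proof.
move=> b_gt0; exists (trunc_log 2 b), (b - 2 ^ trunc_log 2 b).
have /andP[le_b lt_b] := trunc_log_bounds (isT : 1 < 2) b_gt0.
by split; [move: lt_b; rewrite expnS; lia | rewrite subnKC].
Qed.

Lemma omega_top j b : b < 2 ^ j -> omega (2 ^ j + b) = (omega b).+1.
Proof. by move=> lt_b; rewrite /omega bin_powers_top // size_rcons. Qed.

Lemma zmax_top j b : b < 2 ^ j -> zmax (2 ^ j + b) = 2 ^ j.
Proof. by move=> lt_b; rewrite /zmax bin_powers_top // last_rcons. Qed.

Lemma omega_gt0 b : 0 < b -> 0 < omega b.
Proof. by case/pow2_split=> j [b' [lt_b ->]]; rewrite omega_top. Qed.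

Lemma vmin_top j b : 0 < b < 2 ^ j -> vmin (2 ^ j + b) = vmin b.
Proof.
case/andP=> /omega_gt0 b_gt0 lt_b; rewrite /vmin bin_powers_top // headI /=.
by move: b_gt0; rewrite /omega; case: (bin_powers b).
Qed.

Lemma vmin_pow2 j : vmin (2 ^ j) = 2 ^ j.
Proof. by rewrite /vmin -{1}[2 ^ j]addn0 bin_powers_top ?expn_gt0. Qed.

Lemma zmax_lt_pow2 j b : 0 < b -> (zmax b < 2 ^ j) = (b < 2 ^ j).
Proof.
case/pow2_split=> i [b' [lt_b ->]]; rewrite zmax_top //.
apply/idP/idP => [|lt_j]; last by apply: leq_ltn_trans lt_j; apply: leq_addr.
rewrite ltn_exp2l // => lt_ij; apply: (@leq_trans (2 ^ i.+1)).
  by rewrite expnS; lia.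
by rewrite leq_exp2l.
Qed.

Lemma vmin_lt k b : 0 < b < 2 ^ k -> exists2 r, r < k & vmin b = 2 ^ r.
Proof.
case/andP=> /omega_gt0 b_gt0 lt_b.
have : vmin b \in bin_powers b.
  rewrite /vmin; move: b_gt0; rewrite /omega.
  by case: (bin_powers b) => //= *; rewrite mem_head.
rewrite (bin_powersE lt_b) => /mapP[r]; rewrite mem_filter mem_iota.
by case/and3P=> _ _ lt_r ->; exists r.
Qed.

Lemma vmin_eq1 b : (vmin b == 1) = (1 \in bin_powers b).
Proof.
have := sorted_bin_powers b; rewrite /vmin.
have : all (leq 1) (bin_powers b).
  by apply/allP => p /mapP[i _ ->]; rewrite expn_gt0.
case: (bin_powers b) => //= p s /andP[p_gt0 _] lt_s; rewrite inE eq_sym.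
case: eqP => //= p_neq1; apply/esym/negbTE/negP => s1.
by have /allP/(_ _ s1) := order_path_min ltn_trans lt_s; lia.
Qed.

(** * Sums over words *)

(** Words grow at the right end, where the smallest part stands: appending a
    smallest part acts uniformly on the values of all the others. *)
Fixpoint words (T : Type) (A : seq T) (L : nat) : seq (seq T) :=
  if L is L'.+1 then [seq rcons w a | w <- words A L', a <- A] else [:: [::]].

Lemma mem_words (T : eqType) (A : seq T) L w :
  (w \in words A L) = (size w == L) && all (mem A) w.
Proof.
elim: L w => [|L IHL] w /=; first by rewrite inE; case: w.
apply/allpairsP/idP => [[[u a] /= []] | ].
  rewrite IHL => /andP[/eqP <- Au] Aa ->.
  by rewrite size_rcons eqxx all_rcons /= Aa.
case: (lastP w) => // u a; rewrite size_rcons eqSS all_rcons => /and3P[su Aa Au].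
by exists (u, a); split=> //=; rewrite IHL su.
Qed.

Lemma words_uniq (T : eqType) (A : seq T) L : uniq A -> uniq (words A L).
Proof.
move=> uA; elim: L => //= L IHL; apply: allpairs_uniq => //.
by case=> [u a] [v b] _ _ /= /rcons_inj[-> ->].
Qed.

Local Open Scope ring_scope.

Lemma big_words_rcons (V : nmodType) (T : Type) (A : seq T) L (F : seq T -> V) :
  \sum_(w <- words A L.+1) F w
  = \sum_(a <- A) \sum_(w <- words A L) F (rcons w a).
Proof. by rewrite big_allpairs_dep exchange_big. Qed.

Lemma eq_big_words (V : nmodType) (T : eqType) (A : seq T) L (F G : seq T -> V) :
    (forall w, size w = L -> all (mem A) w -> F w = G w) ->
  \sum_(w <- words A L) F w = \sum_(w <- words A L) G w.
Proof.
move=> eqFG; apply: eq_big_seq => w; rewrite mem_words => /andP[/eqP].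
exact: eqFG.
Qed.

Lemma big_words_zip (V : nmodType) (S T : eqType) (A : seq S) (B : seq T) L
    (F : seq (S * T) -> V) :
  \sum_(w <- words [seq (a, b) | a <- A, b <- B] L) F w
  = \sum_(u <- words A L) \sum_(v <- words B L) F (zip u v).
Proof.
elim: L F => [|L IHL] F; first by rewrite !big_seq1.
rewrite !big_words_rcons big_allpairs_dep; apply: eq_bigr => a _.
under eq_bigr do rewrite IHL; rewrite exchange_big.
apply: eq_big_words => u size_u _.
rewrite big_words_rcons; apply: eq_bigr => b _; apply: eq_big_words => v size_v _.
by rewrite zip_rcons // size_u.
Qed.

Lemma big_words_prod (R : comNzRingType) (T : eqType) (x0 : T) (A : seq T) L
    (f : nat -> T -> R) :
  \sum_(w <- words A L) \prod_(i < L) f i (nth x0 w i)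
  = \prod_(i < L) \sum_(a <- A) f i a.
Proof.
elim: L => [|L IHL]; first by rewrite big_seq1 !big_ord0.
rewrite big_words_rcons big_ord_recr -IHL /= mulr_sumr.
apply: eq_bigr => a _; rewrite mulr_suml; apply: eq_big_words => w size_w _.
rewrite big_ord_recr /= nth_rcons size_w ltnn eqxx; congr (_ * _).
by apply: eq_bigr => i _; rewrite nth_rcons size_w ltn_ord.
Qed.

(** * Gaussian binomial coefficients *)

Section Qbinomial.
Variables (R : comNzRingType) (q : R).

(** The exponent n' - m' is truncated, which is harmless: for n' < m' the
    factor it multiplies is zero. *)
Fixpoint qbin (n m : nat) : R :=
  match n, m with
  | _, 0 => 1
  | 0, _.+1 => 0
  | n'.+1, m'.+1 => qbin n' m'.+1 + q ^+ (n' - m') * qbin n' m'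
  end.

Lemma qbin0 n : qbin n 0 = 1. Proof. by case: n. Qed.

Lemma qbinS n m : qbin n.+1 m.+1 = qbin n m.+1 + q ^+ (n - m) * qbin n m.
Proof. by []. Qed.

Lemma qbin_small n m : (n < m)%N -> qbin n m = 0.
Proof.
elim: n m => [|n IHn] [|m] //; rewrite ltnS => lt_nm.
by rewrite qbinS !IHn ?mulr0 ?addr0 // ltnW.
Qed.

Lemma qbin_absorb n m :
  (1 - q ^+ m.+1) * qbin n m.+1 = (1 - q ^+ (n - m)) * qbin n m.
Proof.
elim: n m => [|n IHn] m; first by rewrite /= sub0n subrr mul0r mulr0.
have [lt_nm | le_mn] := ltnP n m.
  rewrite qbin_small // mulr0; have [->|neq_m] := eqVneq m n.+1.
    by rewrite subnn subrr mul0r.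
  by rewrite qbin_small ?mulr0 //; lia.
rewrite qbinS mulrDr IHn.
have ->: (1 - q ^+ (n - m)) * qbin n m + (1 - q ^+ m.+1) * (q ^+ (n - m) * qbin n m)
   = (1 - q ^+ (n.+1)) * qbin n m.
  have -> : n.+1 = (m.+1 + (n - m))%N by lia.
  by rewrite exprD; ring.
case: m le_mn => [|m] lt_mn; first by rewrite !qbin0 subn0.
rewrite qbinS subSS mulrDr.
have -> : (1 - q ^+ (n - m)) * (q ^+ (n - m) * qbin n m)
   = q ^+ (n - m) * ((1 - q ^+ m.+1) * qbin n m.+1) by rewrite IHn; ring.
have -> : n.+1 = (m.+1 + (n - m))%N by lia.
by rewrite exprD; ring.
Qed.

End Qbinomial.

Local Open Scope nat_scope.

(** * Minimal values of a pattern *)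

(** The values for which conditions (i) and (iii) are equalities, for a list of
    pairs (color, overlined) ordered from the largest part to the smallest. *)
Fixpoint minvals (w : seq (nat * bool)) : seq nat :=
  if w is a :: w' then
    (if w' is b :: _
     then head 0 (minvals w') + omega a.1 + delta a.1 b.1 - ~~ b.2
     else omega a.1) :: minvals w'
  else [::].

Definition pos_colors (w : seq (nat * bool)) := all (fun a => 0 < a.1) w.

Lemma size_minvals w : size (minvals w) = size w.
Proof. by elim: w => //= a w ->. Qed.

(** A new smallest part shifts all the other minimal values by one and the
    same amount. *)
Lemma minvals_rcons w b o : pos_colors w -> 0 < b ->
  minvals (rcons w (b, o))
  = rcons [seq m + (omega b + delta (last (0, true) w).1 b - ~~ o) | m <- minvals w]
          (omega b).
Proof.
move=> pos_w /omega_gt0 b_gt0; have le_o : ~~ o <= 1 by case: o.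
elim: w pos_w => //= a [|a' w] /= IHw /andP[/omega_gt0 a_gt0 pos_w].
  by congr [:: _; _]; lia.
have le_a : ~~ a'.2 <= 1 by case: a'.2.
have [-> ->] := IHw pos_w; congr [:: _, _ & _]; lia.
Qed.

(** The minimal size when all parts are overlined, that is, the sum of the
    i (omega(c_i) + delta(c_i, c_(i+1))). *)
Definition color_weight (c : seq nat) := sumn (minvals [seq (b, true) | b <- c]).

Lemma color_weight_rcons c b : all (leq 1) c -> 0 < b ->
  color_weight (rcons c b)
  = color_weight c + size c * delta (last 0 c) b + (size c).+1 * omega b.
Proof.
move=> pos_c b_gt0; rewrite /color_weight map_rcons minvals_rcons //; last first.
  by rewrite /pos_colors all_map.
rewrite (last_map (fun b => (b, true))) /= subn0 sumn_rcons.
rewrite -[size c](size_map (fun b => (b, true))) -size_minvals.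
by elim: (minvals _) => [|m s] /=; lia.
Qed.

(** Each non-overlined part lowers by one the values of all the larger parts;
    at index i, counted from 0, there are i of them. *)
Lemma sumn_minvals w : pos_colors w ->
  sumn (minvals w) + \sum_(i < size w) i * ~~ (nth (0, true) w i).2
  = color_weight (unzip1 w).
Proof.
elim/last_ind: w => [|w [b o] IHw]; first by rewrite big_ord0.
rewrite /pos_colors all_rcons => /andP[/= b_gt0 pos_w].
rewrite minvals_rcons // size_rcons big_ord_recr /= nth_rcons ltnn eqxx /=.
rewrite /unzip1 map_rcons color_weight_rcons ?all_map // -/(unzip1 w) -IHw //.
rewrite size_map.
rewrite (last_map fst (w) (0, true)) /= sumn_rcons.
under eq_bigr => i _ do rewrite nth_rcons ltn_ord.
set S := \sum_(i < _) _; set D := delta _ _.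
have -> : sumn [seq m + (omega b + D - ~~ o) | m <- minvals w]
          = sumn (minvals w) + size w * (omega b + D - ~~ o).
  by rewrite -(size_minvals w); elim: (minvals w) => //= m s ->; rewrite mulSn; lia.
have := omega_gt0 b_gt0; case: o => /=; first by lia.
by case: (omega b) => // t _; rewrite addSn subSS subn0; lia.
Qed.

Local Open Scope ring_scope.

(** * The finite identity for overlined parts *)

Section FiniteIdentity.
Variables (R : comNzRingType) (q : R) (k : nat) (y : 'I_k -> R).

Definition color_mono (c : nat) : R :=
  \prod_(i < k | (2 ^ i)%N \in bin_powers c) y i.
Definition word_mono (w : seq nat) : R := \prod_(c <- w) color_mono c.

Definition palette := index_iota 1 (2 ^ k).

Local Notation qb := (qbin q).

(** The total weight of the words of L colors followed by a smaller part of smallest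
    power v, as far as the delta between the two is concerned: this delta
    shifts all L values. For v = 1 it vanishes, see word_sum1E. *)
Definition word_sum v L : R :=
  \sum_(w <- words palette L)
    q ^+ (color_weight w + L * (zmax (last 0%N w) < v)) * word_mono w.

(** The words of L + 1 colors are sorted by their last color b, restricted to
    b < 2 ^ j. The factors are those of the rcons of b, see word_sumS. *)
Definition low_word_sum j L : R :=
  \sum_(1 <= b < 2 ^ j) color_mono b * q ^+ (L.+1 * omega b) * word_sum (vmin b) L.

Lemma pow2_gt0 j : (0 < 2 ^ j)%N. Proof. by rewrite expn_gt0. Qed.

Lemma palette_gt0 L w : w \in words palette L -> all (leq 1) w.
Proof.
rewrite mem_words => /andP[_]; apply: sub_all => b /=.
by rewrite mem_index_iota => /andP[].
Qed.

Lemma word_sum0 v : word_sum v 0 = 1.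
Proof.
by rewrite /word_sum big_seq1 mul0n addn0 expr0 mul1r /word_mono big_nil.
Qed.

Lemma word_sum1E L :
  word_sum 1 L = \sum_(w <- words palette L) q ^+ color_weight w * word_mono w.
Proof.
apply: eq_big_seq => w; case: L => [|L Aw]; first by rewrite mul0n addn0.
have := palette_gt0 Aw; move: Aw; rewrite mem_words => /andP[/eqP].
case: (lastP w) => // u b _ _; rewrite all_rcons last_rcons => /andP[b_gt0 _].
by rewrite (zmax_lt_pow2 0) // ltnNge b_gt0 muln0 addn0.
Qed.

Lemma word_sumS v L :
  word_sum v L.+1 = \sum_(1 <= b < 2 ^ k)
    q ^+ (L.+1 * (zmax b < v))
    * (color_mono b * q ^+ (L.+1 * omega b) * word_sum (vmin b) L).
Proof.
rewrite /word_sum big_words_rcons; apply: eq_big_nat => b /andP[b_gt0 _].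
rewrite !mulr_sumr; apply: eq_big_seq => w Aw.
have size_w : size w = L by move: Aw; rewrite mem_words => /andP[/eqP].
rewrite last_rcons color_weight_rcons ?(palette_gt0 Aw) // size_w.
rewrite /word_mono -cats1 big_cat big_seq1 /= /delta.
by rewrite !exprD; ring.
Qed.

Lemma word_sum1 L : word_sum 1 L.+1 = low_word_sum k L.
Proof.
rewrite word_sumS; apply: eq_big_nat => b /andP[b_gt0 _].
by rewrite (zmax_lt_pow2 0) // ltnNge b_gt0 muln0 expr0 mul1r.
Qed.

(** Only words whose last color is below 2 ^ j notice that a part of smallest
    power 2 ^ j follows. *)
Lemma word_sum_pow2 j L : (j <= k)%N ->
  word_sum (2 ^ j) L.+1 + (1 - q ^+ L.+1) * low_word_sum j L = word_sum 1 L.+1.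
Proof.
move=> le_jk; rewrite word_sum1 word_sumS /low_word_sum.
have le_pow : (2 ^ j <= 2 ^ k)%N by rewrite leq_exp2l.
rewrite !(big_cat_nat (pow2_gt0 j) le_pow) /=.
rewrite addrAC; congr (_ + _).
  rewrite mulr_sumr -big_split; apply: eq_big_nat => b /andP[b_gt0 lt_b] /=.
  by rewrite zmax_lt_pow2 // lt_b muln1; ring.
apply: eq_big_nat => b /andP[le_b lt_b].
have b_gt0 : (0 < b)%N by apply: leq_trans le_b; apply: pow2_gt0.
by rewrite zmax_lt_pow2 // ltnNge le_b muln0 expr0 mul1r.
Qed.

Lemma color_mono_top (j : 'I_k) b : (b < 2 ^ j)%N ->
  color_mono (2 ^ j + b) = y j * color_mono b.
Proof.
move=> lt_b; rewrite /color_mono bin_powers_top //.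
rewrite (bigD1 j) ?mem_rcons ?mem_head //=; congr (_ * _).
apply: eq_bigl => i; rewrite mem_rcons inE.
rewrite eqn_exp2l // -val_eqE /=.
case: eqVneq => [-> | _] /=; last by rewrite andbT.
rewrite (bin_powersE lt_b); apply/esym/negbTE/mapP => -[r].
rewrite mem_filter mem_iota => /and3P[_ _ lt_r] /eqP; rewrite eqn_exp2l //.
by move: lt_r; rewrite add0n => /gtn_eqF ->.
Qed.

(** The last colors between 2 ^ j and 2 ^ j.+1 are 2 ^ j itself and the
    2 ^ j + b with 0 < b < 2 ^ j; the latter have the same vmin as b, and one
    more digit. *)
Lemma low_word_sumS (j : 'I_k) L :
  low_word_sum j.+1 L
  = low_word_sum j L + y j * q ^+ L.+1 * (word_sum (2 ^ j) L + low_word_sum j L).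
Proof.
rewrite /low_word_sum; have le_pow : (2 ^ j <= 2 ^ j.+1)%N by rewrite leq_exp2l.
rewrite (big_cat_nat (pow2_gt0 j) le_pow) /=; congr (_ + _).
have -> : (2 ^ j.+1 = 2 ^ j + 2 ^ j)%N by rewrite expnS mul2n addnn.
rewrite -{1}[(2 ^ j)%N]add0n big_addn addnK big_ltn ?pow2_gt0 // add0n.
rewrite mulrDr; congr (_ + _).
  rewrite vmin_pow2; have := color_mono_top (pow2_gt0 j); rewrite addn0 => ->.
  have := omega_top (pow2_gt0 j); rewrite addn0 => ->.
  by rewrite {1}/color_mono big1 ?mulr1 ?muln1.
rewrite mulr_sumr; apply: eq_big_nat => b /andP[b_gt0 lt_b].
rewrite [(b + _)%N]addnC color_mono_top // omega_top // vmin_top ?b_gt0 //.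
by rewrite mulnS exprD; ring.
Qed.

(** Pascal's rule splits [n + 1, L + 1]; the second of the two resulting sums
    keeps only the words with last color below 2 ^ j. This interpolates between
    the total for n, at j = 0, and the total for n + 1, at j = k. *)
Definition low_total n j : R :=
  \sum_(L < n.+1) word_sum 1 L * qb n L
  + \sum_(L < n.+1) q ^+ (n - L) * low_word_sum j L * qb n L.

(** The absorption rule (1 - q ^ (L+1)) [n, L+1] = (1 - q ^ (n-L)) [n, L] matches
    the factor 1 - q ^ (L+1) of word_sum_pow2. *)
Lemma low_totalE n j : (j <= k)%N ->
  low_total n j = \sum_(L < n.+1) (word_sum (2 ^ j) L + low_word_sum j L) * qb n L.
Proof.
move=> le_jk; rewrite /low_total big_ord_recl.
rewrite (eq_bigr (fun L : 'I_n => word_sum (2 ^ j) L.+1 * qb n L.+1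
          + (1 - q ^+ (n - L)) * qb n L * low_word_sum j L)); last first.
  move=> L _ /=; rewrite -qbin_absorb -(word_sum_pow2 _ le_jk); ring.
have -> : word_sum 1 (@ord0 n) = word_sum (2 ^ j) (@ord0 n).
  by rewrite !word_sum0.
rewrite big_split /= addrA.
rewrite -(big_ord_recl _ (fun L => word_sum (2 ^ j) L * qb n L)).
rewrite -addrA [RHS](eq_bigr _ (fun L _ => mulrDl _ _ _)) big_split /=.
congr (_ + _); rewrite !big_ord_recr /= subnn expr0 mul1r addrA; congr (_ + _).
by rewrite -big_split; apply: eq_bigr => L _ /=; ring.
Qed.

Lemma low_totalS n (j : 'I_k) :
  low_total n j.+1 = (1 + y j * q ^+ n.+1) * low_total n j.
Proof.
rewrite mulrDl mul1r [X in _ = _ + _ * X]low_totalE ?(ltnW (ltn_ord j)) //.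
rewrite /low_total -addrA.
congr (_ + _); rewrite mulr_sumr -big_split; apply: eq_bigr => L _ /=.
rewrite low_word_sumS.
have -> : q ^+ n.+1 = q ^+ (n - L) * q ^+ L.+1.
  by rewrite -exprD addnS subnK // -ltnS.
by ring.
Qed.

(** The words of colors subject to Andrews' difference conditions, with values
    bounded through n: a finite form of the identity for d = 0. *)
Lemma sum_words_qbin n :
  \sum_(L < n.+1) word_sum 1 L * qb n L
  = \prod_(i < k) \prod_(r < n) (1 + y i * q ^+ r.+1).
Proof.
elim: n => [|n IHn].
  by rewrite big_ord1 word_sum0 mulr1 big1 // => i _; rewrite big_ord0.
have -> : \sum_(L < n.+2) word_sum 1 L * qb n.+1 L = low_total n k.
  rewrite big_ord_recl (eq_bigr (fun L : 'I_n.+1 => word_sum 1 L.+1 * qb n L.+1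
            + q ^+ (n - L) * low_word_sum k L * qb n L)); last first.
    by move=> L _; rewrite -word_sum1 [qb _ _]qbinS; ring.
  rewrite big_split addrA; congr (_ + _).
  have -> : qb n.+1 ord0 = qb n 0 by rewrite !qbin0.
  rewrite -(big_ord_recl _ (fun L => word_sum 1 L * qb n L)) big_ord_recr /=.
  by rewrite qbin_small // mulr0 addr0.
have -> : low_total n k = (\prod_(i < k) (1 + y i * q ^+ n.+1)) * low_total n 0.
  suff low j : (j <= k)%N -> low_total n j
      = (\prod_(i < k | (i < j)%N) (1 + y i * q ^+ n.+1)) * low_total n 0.
    by rewrite low //; congr (_ * _); apply: eq_bigl => i; rewrite ltn_ord.
  elim: j => [|j IHj] lt_jk; first by rewrite big_pred0 ?mul1r.
  rewrite (low_totalS n (Ordinal lt_jk)) IHj ?(ltnW lt_jk) // mulrA.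
  congr (_ * _).
  rewrite [RHS](bigD1 (Ordinal lt_jk)) //=; congr (_ * _); apply: eq_bigl => i.
  by rewrite -val_eqE /= ltnS ltn_neqAle andbC.
have -> : low_total n 0 = \sum_(L < n.+1) word_sum 1 L * qb n L.
  rewrite /low_total [X in _ + X]big1 ?addr0 // => L _.
  by rewrite /low_word_sum big_geq // mulr0 mul0r.
rewrite IHn -big_split; apply: eq_bigr => i _.
by rewrite big_ord_recr /= mulrC.
Qed.

End FiniteIdentity.

(** * Refinement by odd colors, and overlining *)

Lemma rmorph_qbin (R S : comNzRingType) (f : {rmorphism R -> S}) q n m :
  qbin (f q) n m = f (qbin q n m).
Proof.
elim: n m => [|n IHn] [|m]; rewrite ?rmorph1 ?rmorph0 //.
by rewrite !qbinS !IHn rmorphD rmorphM rmorphXn.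
Qed.

(** The finite q-binomial theorem, read coefficientwise. *)
Lemma coef_prod_qbin (R : comNzRingType) (q : R) n a :
  (\prod_(r < n) (1 + 'X * (q ^+ r.+1)%:P))`_a
  = q ^+ (\sum_(i < a) i.+1) * qbin q n a.
Proof.
elim: n a => [|n IHn] a.
  rewrite big_ord0 coef1; case: a => [|a]; first by rewrite big_ord0 mulr1.
  by rewrite mulr0.
rewrite big_ord_recr [in LHS]/= mulrDr mulr1 coefD IHn mulrA coefMC coefMX.
case: a => [|a]; first by rewrite !qbin0 big_ord0 mul0r addr0.
rewrite [_.-1]/= [_ == _]/= IHn qbinS mulrDr; congr (_ + _).
rewrite big_ord_recr exprD /=; have [lt_na | le_an] := ltnP n a.
  by rewrite qbin_small // !(mulr0, mul0r).
have -> : q ^+ n.+1 = q ^+ a.+1 * q ^+ (n - a) by rewrite -exprD addSn subnKC.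
by ring.
Qed.

Definition has_one (c : nat) := 1%N \in bin_powers c.

Section Refinement.
Variables (R : comNzRingType) (q d : R) (k : nat) (y : 'I_k -> R).
Variable k_gt0 : (0 < k)%N.
Let i0 := Ordinal k_gt0.

Lemma word_monoE (S : comNzRingType) (z : 'I_k -> S) w :
  word_mono z w
  = \prod_(i < k) z i ^+ count (fun c => (2 ^ i)%N \in bin_powers c) w.
Proof.
rewrite /word_mono /color_mono; under eq_bigr do rewrite big_mkcond.
rewrite exchange_big; apply: eq_bigr => i _.
by rewrite -big_mkcond /= big_const_seq iter_mulr_1.
Qed.

Definition word_mono_rest w : R :=
  \prod_(i < k | i != i0) y i ^+ count (fun c => (2 ^ i)%N \in bin_powers c) w.

Lemma word_mono_restE w :
  word_mono y w = y i0 ^+ count has_one w * word_mono_rest w.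
Proof. by rewrite word_monoE (bigD1 i0). Qed.

Definition odd_word_sum a L : R :=
  \sum_(w <- words (palette k) L | count has_one w == a)
    q ^+ color_weight w * word_mono_rest w.

Definition other_prod n : R :=
  \prod_(i < k | i != i0) \prod_(r < n) (1 + y i * q ^+ r.+1).

(** Replacing the variable of the digit 1 by a polynomial indeterminate turns
    the number of odd colors into a degree, so that this is a coefficient of
    sum_words_qbin over {poly R}. *)
Lemma sum_odd_word_sums n a :
  \sum_(L < n.+1) odd_word_sum a L * qbin q n L
  = q ^+ (\sum_(i < a) i.+1) * qbin q n a * other_prod n.
Proof.
pose z i : {poly R} := if i == i0 then 'X else (y i)%:P.
have := sum_words_qbin q%:P z n.
move=> /(congr1 (fun p : {poly R} => p`_a)); rewrite coef_sum => eq_a.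
transitivity (\sum_(L < n.+1) (word_sum q%:P z 1 L * qbin q%:P n L)`_a).
  apply: eq_bigr => L _; rewrite (rmorph_qbin (@polyC R)) coefMC; congr (_ * _).
  rewrite word_sum1E coef_sum /odd_word_sum big_mkcond; apply: eq_bigr => w _.
  have -> : word_mono z w = 'X^(count has_one w) * (word_mono_rest w)%:P.
    rewrite word_monoE (bigD1 i0) //= /z eqxx; congr (_ * _).
    rewrite rmorph_prod; apply: eq_bigr => i /negbTE ->.
    by rewrite rmorphXn.
  rewrite -rmorphXn mulrCA coefXnM -rmorphM coefC.
  case: (ltngtP a (count has_one w)) => [//|lt_a|->].
    by rewrite subn_eq0 leqNgt lt_a.
  by rewrite subnn.
rewrite eq_a (bigD1 i0) //= -coef_prod_qbin.
rewrite /other_prod -[RHS]coefMC rmorph_prod.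
congr (polyseq _)`_a; congr (_ * _).
  apply: eq_bigr => r _; by rewrite /z eqxx rmorphXn.
apply: eq_bigr => i /negbTE i_neq; rewrite rmorph_prod.
by apply: eq_bigr => r _; rewrite /z i_neq rmorphD rmorphM rmorphXn rmorph1.
Qed.

(** Condition (iv). Every color has exactly one smallest power of 2, hence the
    parts that are not among the last s are as many as the parts of odd color;
    see cond_overlinedE. *)
Definition tail_overlined (w : seq (nat * bool)) :=
  all snd (drop (count (fun a => has_one a.1) w) w).

Lemma tail_overlined_zip c o : size c = size o ->
  tail_overlined (zip c o)
  = [forall i : 'I_(size o), (i < count has_one c)%N || nth true o i].
Proof.
move=> size_co.
have unzip2K : map snd (zip c o) = o by apply: unzip2_zip; rewrite size_co.
have unzip1K : map fst (zip c o) = c by apply: unzip1_zip; rewrite size_co.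
rewrite /tail_overlined -(all_map snd id) map_drop unzip2K.
rewrite -(count_map fst has_one) unzip1K.
apply/(all_nthP true)/forallP => [late i | late i].
  have [//|le_i] /= := ltnP i (count has_one c).
  have := late (i - count has_one c)%N; rewrite nth_drop subnKC //=; apply.
  by rewrite size_drop ltn_sub2r // (leq_ltn_trans le_i).
rewrite size_drop nth_drop ltn_subRL => lt_i.
by have := late (Ordinal lt_i); rewrite /= ltnNge leq_addr.
Qed.

(** Among the first a parts, the part of index i contributes 1 if overlined and
    d q^(-i) otherwise. Multiplication by the product of the q^i avoids
    negative exponents. *)
Lemma sum_tail_overlined c L : size c = L -> all (leq 1) c ->
  let a := count has_one c in
  q ^+ (\sum_(i < a) i) *
    (\sum_(o <- words [:: true; false] L | tail_overlined (zip c o))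
      q ^+ sumn (minvals (zip c o)) * d ^+ count negb o)
  = q ^+ color_weight c * \prod_(i < a) (q ^+ i + d).
Proof.
move=> size_c c_gt0 a; have le_aL : (a <= L)%N by rewrite -size_c count_size.
(* The factor 0 given by b%:R to a non-overlined part beyond index a encodes
   the condition tail_overlined. *)
pose f i b : R := if (i < a)%N then if b then q ^+ i else d else b%:R.
have -> : \prod_(i < a) (q ^+ i + d)
    = \prod_(i < L) \sum_(b <- [:: true; false]) f i b.
  rewrite (big_ord_widen _ (fun i => q ^+ i + d) le_aL) big_mkcond.
  apply: eq_bigr => i _; rewrite big_cons big_seq1 /f.
  by case: ifP; rewrite // addr0.
rewrite -(big_words_prod true) [X in _ * X = _]big_mkcond !mulr_sumr.
apply: eq_big_words => o size_o _.
rewrite tail_overlined_zip ?size_c // size_o.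
case: ifPn => [/forallP late | /forallPn[i]]; last first.
  rewrite negb_or => /andP[/negbTE ge_ia /negbTE o_i].
  by rewrite (bigD1 i) //= /f ge_ia o_i mul0r !mulr0.
have unzip1K : unzip1 (zip c o) = c by apply: unzip1_zip; rewrite size_c size_o.
have size_zip_o : size (zip c o) = L by rewrite size_zip size_c size_o minnn.
have -> : color_weight c
    = (sumn (minvals (zip c o)) + \sum_(i < L) i * ~~ nth true o i)%N.
  rewrite -{1}unzip1K -sumn_minvals; last first.
    by rewrite /pos_colors -(all_map fst (leq 1)) -/(unzip1 _) unzip1K.
  rewrite size_zip_o; congr addn; apply: eq_bigr => i _.
  by rewrite nth_zip ?size_c ?size_o.
have -> : \prod_(i < L) f i (nth true o i)
    = q ^+ (\sum_(i < L) i * ((i < a) && nth true o i)) * d ^+ count negb o.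
  have -> : count negb o = (\sum_(i < L) ~~ nth true o i)%N.
    rewrite -sumn_count sumnE big_map (big_nth true) size_o big_mkord.
    by apply: eq_bigr.
  rewrite -!prodrXr -big_split; apply: eq_bigr => i _ /=; rewrite /f.
  have := late i; case: ltnP => _ /=; case: (nth true o i) => //= _;
    by rewrite ?muln1 ?muln0 ?expr0 ?mul1r ?mulr1.
rewrite !mulrA; congr (_ * _); rewrite -!exprD; congr (q ^+ _).
rewrite (big_ord_widen _ id le_aL) big_mkcond /= addnC -addnA; congr addn.
rewrite -big_split; apply: eq_bigr => i _ /=; have := late i.
by case: ltnP => _ /=; case: (nth true o i) => //= _; lia.
Qed.

Definition pattern_sum L : R :=
  \sum_(w <- words [seq (c, o) | c <- palette k, o <- [:: true; false]] L
        | tail_overlined w)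
    q ^+ sumn (minvals w) * d ^+ count (fun a => ~~ a.2) w
    * word_mono y (unzip1 w).

Definition odd_pattern_sum a L : R :=
  \sum_(c <- words (palette k) L | count has_one c == a)
    (\sum_(o <- words [:: true; false] L | tail_overlined (zip c o))
       q ^+ sumn (minvals (zip c o)) * d ^+ count negb o) * word_mono_rest c.

Lemma pattern_sumE L n : (L <= n)%N ->
  pattern_sum L = \sum_(a < n.+1) y i0 ^+ a * odd_pattern_sum a L.
Proof.
move=> le_Ln; rewrite /pattern_sum big_mkcond big_words_zip.
under [RHS]eq_bigr do rewrite /odd_pattern_sum big_mkcond mulr_sumr.
rewrite [RHS]exchange_big; apply: eq_big_words => c size_c _.
have lt_a : (count has_one c < n.+1)%N.
  by rewrite ltnS (leq_trans (count_size _ _)) // size_c.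
rewrite (bigD1 (Ordinal lt_a)) //= eqxx [X in _ + X]big1 ?addr0; last first.
  by move=> i; rewrite -val_eqE /= eq_sym => /negbTE ->; rewrite mulr0.
rewrite mulrCA -word_mono_restE mulr_suml [RHS]big_mkcond.
apply: eq_big_words => o size_o _; case: ifP => // _.
rewrite unzip1_zip ?size_c ?size_o //; congr (_ * d ^+ _ * _).
by rewrite -(count_map snd negb) -/(unzip2 _) unzip2_zip ?size_c ?size_o.
Qed.

Lemma odd_pattern_sumE a L :
  q ^+ (\sum_(i < a) i) * odd_pattern_sum a L
  = \prod_(i < a) (q ^+ i + d) * odd_word_sum a L.
Proof.
rewrite /odd_pattern_sum /odd_word_sum !mulr_sumr [LHS]big_mkcond [RHS]big_mkcond.
apply: eq_big_words => c size_c Ac; case: eqP => // <-.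
have c_gt0 : all (leq 1) c.
  by apply: (palette_gt0 (k := k) (L := L)); rewrite mem_words size_c eqxx.
by rewrite !mulrA; congr (_ * _); rewrite (sum_tail_overlined size_c c_gt0) mulrC.
Qed.

(** A truncation of the series (-u;q)_oo / (u d;q)_oo, in which the Gaussian
    binomial stands for 1 / (q;q)_a. *)
Definition over_sum n u : R :=
  \sum_(a < n.+1) qbin q n a * u ^+ a * \prod_(i < a) (q ^+ i + d).

(** The factor q^(a(a-1)/2) of odd_pattern_sumE also occurs on the side of the
    product, since a(a+1)/2 = a(a-1)/2 + a; this is where q must be regular. *)
Lemma sum_pattern_sums n : GRing.lreg q ->
  \sum_(L < n.+1) pattern_sum L * qbin q n L = other_prod n * over_sum n (y i0 * q).
Proof.
move=> q_reg.
have sum_unit a : \sum_(L < n.+1) odd_pattern_sum a L * qbin q n L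
    = q ^+ a * \prod_(i < a) (q ^+ i + d) * qbin q n a * other_prod n.
  have: GRing.lreg (q ^+ (\sum_(i < a) i)) by apply: lregX.
  apply; rewrite mulr_sumr.
  under eq_bigr do rewrite mulrA odd_pattern_sumE -mulrA.
  rewrite -mulr_sumr sum_odd_word_sums.
  under [X in q ^+ X]eq_bigr do rewrite -addn1.
  by rewrite big_split sum1_card card_ord exprD /=; ring.
rewrite mulr_sumr.
under eq_bigr => L _ do rewrite (pattern_sumE (ltn_ord L : (L <= n)%N)) mulr_suml.
rewrite exchange_big; apply: eq_bigr => a _ /=.
under eq_bigr do rewrite -mulrA.
by rewrite -mulr_sumr sum_unit exprMn; ring.
Qed.

(** The limit F satisfies (1 - u d) F(u) = (1 + u) F(u q). The error term comes
    from 1 - q ^ (n-a) replacing 1 in the absorption rule. *)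
Lemma over_sum_shift n u :
  over_sum n u * (1 - u * d)
   + \sum_(a < n.+1) u ^+ a.+1 * q ^+ (n - a)
       * (qbin q n a * \prod_(i < a.+1) (q ^+ i + d))
  = (1 + u) * over_sum n (u * q).
Proof.
pose D a := \prod_(i < a) (q ^+ i + d).
have DS a : D a.+1 = D a * (q ^+ a + d) by rewrite /D big_ord_recr.
have shift : over_sum n u - over_sum n (u * q)
   = \sum_(a < n.+1) (1 - q ^+ (n - a)) * qbin q n a * u ^+ a.+1 * D a.+1.
  rewrite /over_sum -sumrB [LHS]big_ord_recl [RHS]big_ord_recr /=.
  rewrite subnn !subrr !mul0r addr0 add0r; apply: eq_bigr => a _.
  by rewrite /bump /= -qbin_absorb -/(D _) exprMn add1n; ring.
have next : u * d * over_sum n u + u * over_sum n (u * q)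
   = \sum_(a < n.+1) qbin q n a * u ^+ a.+1 * D a.+1.
  rewrite /over_sum !mulr_sumr -big_split; apply: eq_bigr => a _ /=.
  by rewrite DS -/(D _) exprMn exprS; ring.
set E := \sum_(a < _) _; have : over_sum n u - over_sum n (u * q) + E
   = u * d * over_sum n u + u * over_sum n (u * q).
  rewrite shift next -big_split; apply: eq_bigr => a _ /=.
  by rewrite -/(D _); ring.
move=> eqE; have -> : E = u * d * over_sum n u + u * over_sum n (u * q)
    - (over_sum n u - over_sum n (u * q)) by rewrite -eqE; ring.
by ring.
Qed.

End Refinement.

Local Open Scope nat_scope.

(** * The counted overpartitions *)

(** The partitions that the Gaussian binomial [n, L] enumerates: L parts, zeros
    allowed, each at most n - L. Pascal's rule asks whether the largest part
    reaches the bound. *)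
Fixpoint box (n L : nat) : seq (seq nat) :=
  match n, L with
  | _, 0 => [:: [::]]
  | 0, _.+1 => [::]
  | n'.+1, L'.+1 => box n' L'.+1 ++ [seq (n' - L') :: nu | nu <- box n' L']
  end.

Lemma mem_box n L nu :
  (nu \in box n L) = [&& size nu == L, L <= n, sorted geq nu & all (geq (n - L)) nu].
Proof.
have geq_trans : transitive geq.
  by move=> u v w /= le_uv le_wu; apply: leq_trans le_wu _.
elim: n L nu => [|n IHn] [|L] nu; rewrite ?inE ?leq0n; try by case: nu.
  by rewrite ltn0 andbF.
rewrite ltnS subSS mem_cat IHn; case: nu => [|v nu] //=.
  by apply/negbTE/mapP => -[].
rewrite eqSS path_sortedE //.
have -> : (v :: nu \in [seq n - L :: nu0 | nu0 <- box n L])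
    = (v == n - L) && (nu \in box n L).
  apply/mapP/andP => [[nu' nu'_box [-> ->]] | [/eqP-> nu_box]].
    by rewrite eqxx.
  by exists nu.
rewrite IHn; have [size_nu /=|] := eqVneq (size nu) L; last by rewrite !andbF.
case: (boolP (sorted geq nu)) => [_ |]; last by rewrite !andbF.
have [le_Ln | lt_nL] := leqP L n; last by rewrite !andbF /= leqNgt ltnW.
rewrite /= !andbT.
apply/orP/and3P => [[/and4P[lt_Ln v_nu le_v all_nu] | /andP[/eqP-> all_nu]]
                   | [v_nu le_v all_nu]].
- split=> //; first by lia.
  by apply: sub_all all_nu => u /=; lia.
- by split.
have [->|neq_v] := eqVneq v (n - L); [by right; rewrite all_nu | left].
apply/and4P; split=> //; try lia.
by apply: sub_all v_nu => u /=; lia.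
Qed.

Lemma box_uniq n L : uniq (box n L).
Proof.
elim: n L => [|n IHn] [|L] //=; rewrite cat_uniq IHn map_inj_uniq ?IHn; last first.
  by move=> ? ? [].
rewrite andbT /=; apply/hasPn => _ /mapP[nu _ ->]; rewrite mem_box /=.
by apply/negP => /and5P[_ lt_Ln _ le_L _]; lia.
Qed.

Lemma sum_box (R : comNzRingType) (q : R) n L :
  (\sum_(nu <- box n L) q ^+ sumn nu = qbin q n L)%R.
Proof.
elim: n L => [|n IHn] [|L]; rewrite ?big_seq1 ?big_nil //.
rewrite big_cat big_map IHn qbinS -(IHn L) mulr_sumr; congr (_ + _)%R.
by apply: eq_bigr => nu _; rewrite exprD.
Qed.

(** A name of its own keeps this value folded under simplification. *)
Definition top_minval w := head 0 (minvals w).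
Arguments top_minval : simpl never.

Fixpoint build (w : seq (nat * bool)) (nu : seq nat) : seq part :=
  match w, nu with
  | a :: w', v :: nu' => (v + top_minval w, a.1, a.2) :: build w' nu'
  | _, _ => [::]
  end.

Definition pattern (l : seq part) : seq (nat * bool) :=
  [seq (pcol p, pover p) | p <- l].

Lemma pattern_build w nu : size nu = size w -> pattern (build w nu) = w.
Proof.
elim: w nu => [|[c o] w IHw] [|v nu] //= [size_nu].
by rewrite /pcol /pover /= -[in RHS](IHw nu).
Qed.

Lemma pval_build w nu : size nu = size w ->
  map pval (build w nu) = [seq m.1 + m.2 | m <- zip nu (minvals w)].
Proof. by elim: w nu => [|a w IHw] [|v nu] //= [size_nu]; rewrite IHw. Qed.

Lemma sumn_build w nu : size nu = size w ->
  sumn (map pval (build w nu)) = sumn nu + sumn (minvals w).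
Proof.
by elim: w nu => [|a w IHw] [|v nu] //= [size_nu]; rewrite IHw // addnACA.
Qed.

Lemma build_inj w w' nu nu' : size nu = size w -> size nu' = size w' ->
  build w nu = build w' nu' -> w = w' /\ nu = nu'.
Proof.
move=> size_nu size_nu' eq_b; have := congr1 pattern eq_b.
rewrite !pattern_build // => eq_w; subst w'; split=> //.
have := congr1 (map pval) eq_b; rewrite !pval_build //.
rewrite -(size_minvals w) in size_nu size_nu'.
elim: (minvals w) nu nu' size_nu size_nu' {eq_b}
  => [|m s IHs] [|v nu] [|v' nu'] //=.
by move=> [size_nu] [size_nu'] [/addIn-> /IHs->].
Qed.

Lemma minvals_gt0 w : pos_colors w -> all (leq 1) (minvals w).
Proof.
elim: w => //= a w IHw /andP[/omega_gt0 a_gt0 /IHw]; case: w {IHw} => [|b w] /=.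
  by rewrite a_gt0.
case/andP=> le1 ->; rewrite le1 andbT /=.
by have : ~~ b.2 <= 1 by [case: b.2]; lia.
Qed.

Lemma top_minval_cons a b w : 0 < a.1 ->
  top_minval (a :: b :: w) + ~~ b.2
  = top_minval (b :: w) + omega a.1 + delta a.1 b.1.
Proof.
move=> /omega_gt0 a_gt0; rewrite /top_minval; set h := head 0 (minvals (b :: w)).
have -> : head 0 (minvals (a :: b :: w))
    = h + omega a.1 + delta a.1 b.1 - ~~ b.2 by [].
by case: b.2 => /=; lia.
Qed.

(** Subtracting the minimal values turns the difference conditions into the
    monotonicity that defines a partition. *)
Lemma cond_build w nu : pos_colors w -> size nu = size w ->
  cond_smallest (build w nu) && cond_diff (build w nu) = sorted geq nu.
Proof.
elim: w nu => [|a [|b w] IHw] [|v nu] //=.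
  by case: nu => //= _ _; rewrite leq_addl.
case: nu => [|v' nu] // /andP[a_gt0 pos_w] [size_nu].
have /= := IHw (v' :: nu) pos_w; rewrite size_nu => <- //.
have := top_minval_cons b w a_gt0; rewrite /cond_diff /= /pval /pcol /pover /=.
set h := top_minval _; set h' := top_minval _ => eq_h.
rewrite andbCA; congr (_ && _); by apply/idP/idP => /=; lia.
Qed.

Definition pos_parts (l : seq part) := all (fun p => 0 < pcol p) l.

Lemma cond_build_ex l : pos_parts l -> cond_smallest l -> cond_diff l ->
  exists2 nu, size nu = size l & l = build (pattern l) nu.
Proof.
elim: l => [|p [|p' l] IHl] /=; first by exists [::].
  move=> _ le_p _; exists [:: pval p - omega (pcol p)] => //=.
  by rewrite subnK //; case: p {le_p} => [[]].
case/andP=> p_gt0 pos_l le_l /andP[le_p cond_l].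
have [[|v nu] //= size_nu [eq_p' eq_l]] := IHl pos_l le_l cond_l.
have := @top_minval_cons (pcol p, pover p) (pcol p', pover p') (pattern l) p_gt0.
have eq_v : pval p' = v + top_minval ((pcol p', pover p') :: pattern l).
  by rewrite {1}eq_p'.
rewrite -/(pattern l) in eq_p' eq_l *.
set h := top_minval (_ :: _ :: _) => /= eq_h.
exists (pval p - h :: v :: nu) => /=; first by rewrite size_nu.
rewrite -/h -eq_p' -eq_l subnK; last by lia.
by case: (p) => [[]].
Qed.

(** As omega is positive, condition (iii) makes the values weakly decrease, and allows
    equal consecutive values only before a non-overlined part. *)
Lemma cond_implies l : pos_parts l -> cond_smallest l -> cond_diff l ->
  [/\ sorted geq (map pval l), all (fun p => 0 < pval p) l
    & sorted (fun p p' => (pval p == pval p') ==> ~~ pover p') l].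
Proof.
elim: l => [|p [|p' l] IHl] //=.
  by move=> /andP[/omega_gt0 p_gt0 _] le_p _; rewrite (leq_trans p_gt0).
case/andP=> /omega_gt0 p_gt0 pos_l le_l /andP[le_p cond_l].
have [/= -> /andP[p'_gt0 ->] ->] := IHl pos_l le_l cond_l.
rewrite !andbT p'_gt0 /=.
by case: pover le_p => /= le_p; split; rewrite ?implybT ?andbT //; lia.
Qed.

Definition valid (k : nat) (l : seq part) : bool :=
  [&& all (fun p => 1 <= pcol p <= 2 ^ k - 1) l, cond_smallest l, cond_diff l
    & cond_overlined k l].

(** The requirements that make a list of parts an overpartition follow from the
    difference conditions, see cond_implies. *)
Lemma is_countedE k x m s l :
  @is_counted k x m s l
  = [&& valid k l, sumn (map pval l) == s, count (fun p => ~~ pover p) l == m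
      & cond_colors x l].
Proof.
rewrite /is_counted /is_colored_overpartition /valid.
apply/idP/idP.
  by case/and5P=> /and5P[_ _ -> _ ->] -> -> -> /andP[-> ->].
case/and4P=> /and4P[col_l small_l diff_l ->] -> -> ->; rewrite col_l small_l diff_l.
have pos_l : pos_parts l by apply: sub_all col_l => p /andP[].
by have [-> -> ->] := cond_implies pos_l small_l diff_l.
Qed.

(** The smallest power of a color below 2 ^ k is 2 ^ r for exactly one r < k,
    and r = 0 holds for the odd colors; so s is the number of even colors. *)
Lemma cond_overlinedE k l : all (fun p => 1 <= pcol p <= 2 ^ k - 1) l ->
  cond_overlined k l = tail_overlined (pattern l).
Proof.
move=> col_l; rewrite /cond_overlined /tail_overlined /pattern.
rewrite count_map -map_drop all_map.
congr (all _ (drop _ _)).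
suff : count (fun p => has_one (pcol p)) l
   + \sum_(1 <= r < k) count (fun p => vmin (pcol p) == 2 ^ r) l = size l.
  by move=> <-; rewrite addnK.
elim: l col_l => [_|p l IHl /= /andP[/andP[p_gt0 le_p] /IHl <-]] /=.
  by rewrite big1.
rewrite big_split /= addnACA -[RHS]add1n; congr addn.
have [|r lt_r eq_r] := @vmin_lt k (pcol p); first by rewrite p_gt0; lia.
rewrite /has_one -vmin_eq1 eq_r; under eq_bigr do rewrite eqn_exp2l //.
rewrite (eqn_exp2l r 0) //; case: r lt_r {eq_r} => [|r] lt_r /=.
  by rewrite big_nat big1 // => i /andP[]; case: i.
rewrite (bigD1_seq r.+1) ?mem_index_iota ?iota_uniq //= eqxx big1 // => i.
by rewrite eq_sym => /negbTE->.
Qed.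

Definition patterns k n : seq (seq (nat * bool)) :=
  flatten
    [seq [seq w <- words [seq (c, o) | c <- palette k, o <- [:: true; false]] L
         | tail_overlined w]
    | L <- iota 0 n.+1].

Definition counted_lists k n : seq (seq part) :=
  [seq build w nu | w <- patterns k n, nu <- box n (size w)].

Lemma mem_patterns k n w :
  (w \in patterns k n)
  = [&& size w <= n, all (fun a => 1 <= a.1 < 2 ^ k) w & tail_overlined w].
Proof.
apply/flatten_mapP/and3P => [[L] | [size_w col_w late_w]].
  rewrite mem_iota mem_filter mem_words => lt_L /and3P[-> /eqP size_w Aw].
  split=> //; first by rewrite size_w; lia.
  apply: sub_all Aw => a /allpairsP[[c o] [/=]].
  by rewrite mem_index_iota => c_in _ ->.
exists (size w); first by rewrite mem_iota; lia.
rewrite mem_filter late_w mem_words eqxx; apply: sub_all col_w => -[c o] /= c_in.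
change ((c, o) \in [seq (c, o) | c <- palette k, o <- [:: true; false]]).
by apply/allpairsP; exists (c, o); rewrite mem_index_iota c_in; case: o.
Qed.

Lemma patterns_uniq k n : uniq (patterns k n).
Proof.
have A_uniq : uniq [seq (c, o) | c <- palette k, o <- [:: true; false]].
  by apply: allpairs_uniq; rewrite ?iota_uniq // => -[? ?] [? ?].
rewrite /patterns; elim: n.+1 => // N IHN.
rewrite -[N.+1]addn1 iotaD map_cat flatten_cat cat_uniq IHN /= cats0.
rewrite filter_uniq ?words_uniq // andbT; apply/hasPn => w.
rewrite mem_filter mem_words => /and3P[_ /eqP size_w _].
apply/negP => /flatten_mapP[L]; rewrite mem_iota => lt_L.
by rewrite mem_filter mem_words size_w => /and3P[_ /eqP eq_L _]; lia.
Qed.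

Lemma counted_lists_uniq k n : uniq (counted_lists k n).
Proof.
apply: allpairs_uniq_dep => [|w _|]; first exact: patterns_uniq.
  exact: box_uniq.
move=> _ _ /allpairsPdep[w [nu [_ nu_w ->]]]
  /allpairsPdep[w' [nu' [_ nu_w' ->]]] /=; move: nu_w nu_w'.
rewrite !mem_box => /andP[/eqP size_nu _] /andP[/eqP size_nu' _].
by case/(build_inj size_nu size_nu') => eq_w eq_nu; subst.
Qed.

(** A part of the partition nu is at most its sum, and each of the minimal
    values is at least 1, so the sum of the values exceeds that of nu by at
    least L: below the sum n, the bound n - L of box is automatic. *)
Lemma mem_counted_lists k n l : sumn (map pval l) < n ->
  (l \in counted_lists k n) = valid k l.
Proof.
move=> lt_n; apply/allpairsPdep/and4P
  => [[w [nu []]] | [col_l small_l diff_l over_l]].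
  rewrite mem_patterns mem_box => /and3P[size_w col_w late_w].
  case/and4P=> /eqP size_nu _ sorted_nu _ eq_l; subst l.
  have pos_w : pos_colors w by apply: sub_all col_w => a /andP[].
  have := cond_build pos_w size_nu; rewrite sorted_nu => /andP[-> ->].
  have col_l : all (fun p => 1 <= pcol p <= 2 ^ k - 1) (build w nu).
    have := col_w; rewrite -{1}(pattern_build size_nu) all_map.
    by apply: sub_all => p /=; lia.
  by rewrite cond_overlinedE // pattern_build.
have pos_l : pos_parts l by apply: sub_all col_l => p /andP[].
have pos_w : pos_colors (pattern l) by rewrite /pos_colors all_map.
have [nu size_nu eq_l] := cond_build_ex pos_l small_l diff_l.
have size_w : size nu = size (pattern l) by rewrite size_map.
have := sumn_build size_w; rewrite -eq_l => sum_l.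
have ge_size : size l <= sumn (minvals (pattern l)).
  rewrite -[size l](size_map (fun p => (pcol p, pover p))) -size_minvals.
  by elim: (minvals _) (minvals_gt0 pos_w) => //= m s IHs /andP[m_gt0 /IHs]; lia.
exists (pattern l), nu; split=> //.
  rewrite mem_patterns size_map -(cond_overlinedE col_l) over_l andbT.
  apply/andP; split; first by lia.
  by rewrite all_map; apply: sub_all col_l => p /=; lia.
rewrite mem_box size_w eqxx -(cond_build pos_w size_w) -eq_l small_l diff_l /=.
apply/andP; split; first by rewrite size_map; lia.
apply/allP => v nu_v /=; rewrite size_map.
have le_v : v <= sumn nu by rewrite sumnE (big_rem v) //= leq_addr.
by lia.
Qed.

Local Open Scope ring_scope.

(** * Power series up to a given degree *)

Section Truncation.
Variables (R : comNzRingType) (n : nat).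
Implicit Types (f g : fps R n) (m : 'X_{1..n}).

(** Equality of formal power series is decided degree by degree, which turns
    each limit needed below into a finite statement. *)
Definition agree N f g := forall m, (mdeg m < N)%N -> f m = g m.

Lemma agree_mul N f f' g g' :
  agree N f f' -> agree N g g' -> agree N (f * g) (f' * g').
Proof.
move=> eq_f eq_g m lt_m; rewrite !fps_coefM; apply: eq_bigr => p _.
have bound (u : 'X_{1..n < (mdeg m).+1}) : (mdeg u < N)%N.
  by apply: leq_ltn_trans lt_m; rewrite -ltnS bmdeg.
by rewrite eq_f ?eq_g.
Qed.

Lemma agree_prod N (I : Type) (r : seq I) (P : pred I) (F G : I -> fps R n) :
  (forall i, P i -> agree N (F i) (G i)) ->
  agree N (\prod_(i <- r | P i) F i) (\prod_(i <- r | P i) G i).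
Proof. by move=> eqFG; elim/big_ind2: _ => // *; apply: agree_mul. Qed.

Lemma agree_refl N f : agree N f f. Proof. by []. Qed.

Lemma agree_trans N g f h : agree N f g -> agree N g h -> agree N f h.
Proof. by move=> fg gh m lt_m; rewrite fg ?gh. Qed.

Definition fps_mono (e : 'X_{1..n}) : fps R n := Fps (fun m => (m == e)%:R).

(** Multiplication by a monomial shifts the coefficients; in particular it is
    injective. *)
Lemma fps_mono_mulE e f m : (f * fps_mono e) (m + e)%MM = f m.
Proof.
rewrite fps_coefM.
have lt1 : (mdeg m < (mdeg (m + e)%MM).+1)%N by rewrite ltnS mdegD leq_addr.
have lt2 : (mdeg e < (mdeg (m + e)%MM).+1)%N by rewrite ltnS mdegD leq_addl.
rewrite (bigD1 (BMultinom lt1, BMultinom lt2)) //= eqxx mulr1 big1 ?addr0 // => p.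
case: p => [p1 p2] /= /andP[/eqP eq_m neq_p].
case: eqP => [eq_e|]; last by rewrite mulr0.
case/eqP: neq_p; congr (_, _); apply: val_inj => //=.
apply: (@addIm _ e); apply/esym/(etrans eq_m).
by congr (_ + _)%MM.
Qed.

Lemma fps_mono0 : fps_mono 0%MM = 1. Proof. by []. Qed.

Lemma fps_monoD e e' : fps_mono (e + e')%MM = fps_mono e * fps_mono e'.
Proof.
apply/fpsP => m; have [le_m | nle_m] := boolP (e' <= m)%MM.
  rewrite -(submK le_m) fps_mono_mulE /=; congr (_%:R : R); congr nat_of_bool.
  by apply/eqP/eqP => [/addIm | ->].
rewrite fps_coefM big1 /=.
  by case: eqP => // eq_m; case/negP: nle_m; rewrite eq_m lem_addl.
move=> p /eqP eq_m.
have [eq_p | _] := eqVneq (p.2 : 'X_{1..n}) e'; last by rewrite mulr0.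
by case/negP: nle_m; rewrite eq_m eq_p lem_addl.
Qed.

Lemma lreg_fpsX (i : 'I_n) : GRing.lreg (fpsX R i).
Proof.
move=> f g eq_fg; apply/fpsP => m.
rewrite -(fps_mono_mulE U_(i) f) -(fps_mono_mulE U_(i) g).
by rewrite mulrC [in RHS]mulrC eq_fg.
Qed.
Lemma agreeD0 N f g : agree N g 0 -> agree N (f + g) f.
Proof. by move=> g0 m lt_m; rewrite fps_coefD g0 ?fps_coef0 ?addr0. Qed.

Lemma agree_sum0 N (I : Type) (r : seq I) (F : I -> fps R n) :
  (forall i, agree N (F i) 0) -> agree N (\sum_(i <- r) F i) 0.
Proof. by move=> F0 m lt_m; rewrite fps_coef_sum big1 // => i _; rewrite F0. Qed.

Lemma agree_high a b N f g h : (N <= a + b)%N -> f 0%MM = 0 -> g 0%MM = 0 ->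
  agree N (f ^+ a * g ^+ b * h) 0.
Proof.
move=> le_N f0 g0 m lt_m; rewrite fps_coef0.
apply: (fps_coefM_eq0 (b := a + b) (c := 0)) => //; last first.
  by rewrite addn0; apply: leq_trans le_N.
apply: fps_coefM_eq0 => m'; exact: fps_coefX_eq0.
Qed.
End Truncation.

(** * The generating series *)

Section Series.
Variables (k : nat) (k_gt0 : (0 < k)%N).
Local Notation A := (fps int (k + 2)).

Definition expo (l : seq part) : 'X_{1..k + 2} :=
  [multinom match split i with
            | inl j => count (fun p => (2 ^ j)%N \in bin_powers (pcol p)) l
            | inr j => if j == ord0 then count (fun p => ~~ pover p) l
                       else sumn (map pval l)
            end | i < k + 2].

Lemma expo_y l j :
  expo l (yvar j) = count (fun p => (2 ^ j)%N \in bin_powers (pcol p)) l.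
Proof. by rewrite mnmE /yvar (unsplitK (inl j : 'I_k + 'I_2)%type). Qed.

Lemma expo_d l : expo l (dvar k) = count (fun p => ~~ pover p) l.
Proof. by rewrite mnmE /dvar (unsplitK (inr ord0 : 'I_k + 'I_2)%type). Qed.

Lemma expo_q l : expo l (qvar k) = sumn (map pval l).
Proof. by rewrite mnmE /qvar (unsplitK (inr ord_max : 'I_k + 'I_2)%type). Qed.

Lemma fps_mono_prod n (e : 'X_{1..n}) : fps_mono int e = \prod_i fpsX int i ^+ e i.
Proof.
rewrite [e in LHS]multinomUE_id.
rewrite (big_morph (@fps_mono int n) (@fps_monoD int n) (fps_mono0 int n)).
apply: eq_bigr => i _; elim: (e i) => [|c IHc]; first by rewrite mulm0n.
by rewrite mulmS fps_monoD IHc exprS.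
Qed.

Lemma expo_build w nu : size nu = size w ->
  fps_mono int (expo (build w nu))
  = q k ^+ sumn nu * (q k ^+ sumn (minvals w) * d k ^+ count (fun a => ~~ a.2) w
      * word_mono (@y k) (unzip1 w)).
Proof.
move=> size_nu; rewrite fps_mono_prod big_split_ord /= big_ord_recl big_ord1.
rewrite -/(dvar k) (_ : lift _ _ = ord_max); last exact: val_inj.
rewrite -/(qvar k) expo_d expo_q sumn_build // exprD.
have -> : count (fun p => ~~ pover p) (build w nu) = count (fun a => ~~ a.2) w.
  by rewrite -{2}(pattern_build size_nu) count_map.
have -> : \prod_(i < k) fpsX int (lshift 2 i) ^+ expo (build w nu) (lshift 2 i)
    = word_mono (@y k) (unzip1 w).
  rewrite word_monoE; apply: eq_bigr => i _; rewrite -/(yvar i) expo_y.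
  congr (_ ^+ _).
  by rewrite -{2}(pattern_build size_nu) !count_map.
rewrite -/(d k) -/(q k); ring.
Qed.

Lemma sum_counted_lists n :
  \sum_(l <- counted_lists k n) fps_mono int (expo l)
  = \sum_(L < n.+1) pattern_sum (q k) (d k) (@y k) L * qbin (q k) n L.
Proof.
rewrite big_allpairs_dep big_flatten big_map.
rewrite -(big_mkord xpredT (fun L => pattern_sum _ _ _ L * qbin _ n L)).
rewrite /index_iota subn0; apply: eq_bigr => L _.
rewrite big_filter /pattern_sum mulr_suml [LHS]big_mkcond [RHS]big_mkcond.
apply: eq_big_words => w size_w _; case: ifP => // _; rewrite size_w.
rewrite -sum_box mulr_sumr; apply: eq_big_seq => nu.
rewrite mem_box => /andP[/eqP size_nu _].
by rewrite expo_build ?size_nu // mulrC.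
Qed.

Lemma Sbar_seriesE n :
  agree n (Sbar_series k)
    (\sum_(L < n.+1) pattern_sum (q k) (d k) (@y k) L * qbin (q k) n L).
Proof.
move=> e lt_e; rewrite -sum_counted_lists fps_coef_sum /=.
have lt_q : (e (qvar k) < n)%N.
  by apply: leq_ltn_trans lt_e; rewrite mdegE (bigD1 (qvar k)) //= leq_addr.
rewrite -(card_is_counted (s := [seq l <- counted_lists k n | expo l == e])).
- rewrite size_filter -sum1_count big_mkcond /= -natz natr_sum.
  by apply: eq_bigr => l _; rewrite eq_sym; case: ifP.
- by rewrite filter_uniq // counted_lists_uniq.
move=> l; rewrite is_countedE mem_filter.
have -> : (expo l == e) = [&& sumn (map pval l) == e (qvar k),
    count (fun p => ~~ pover p) l == e (dvar k)
    & cond_colors (fun i => e (yvar i)) l].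
  apply/eqP/and3P => [<- | [/eqP eq_q /eqP eq_d /forallP eq_y]].
    by rewrite expo_q expo_d; split=> //; apply/forallP => i; rewrite expo_y.
  apply/mnmP => i; rewrite -(splitK i); case: (split i) => j /=.
    by rewrite -/(yvar j) expo_y; apply/eqP.
  have [->|neq_j] := eqVneq j ord0; first by rewrite -/(dvar k) expo_d.
  have -> : j = ord_max by apply: val_inj; case: j neq_j => [[|[|]]].
  by rewrite -/(qvar k) expo_q.
case: eqP => [eq_q|_]; last by rewrite /= andbF.
by rewrite mem_counted_lists ?eq_q //= andbC.
Qed.

Let i0 := Ordinal k_gt0.

Lemma agree_over_sum_shift n (u : A) : u 0%MM = 0 ->
  agree n (over_sum (q k) (d k) n u * (1 - u * d k))
    ((1 + u) * over_sum (q k) (d k) n (u * q k)).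
Proof.
move=> u0; rewrite -over_sum_shift => m lt_m; symmetry.
apply: agreeD0 lt_m; apply: agree_sum0 => a.
(* u ^ (a+1) q ^ (n-a) has degree at least n + 1. *)
apply: agree_high => //; last exact: q_coef0.
by have := ltn_ord a; lia.
Qed.

(** Iterating the shift n times pushes u to y_1 q ^ (n+1), where every term of
    over_sum but the first has degree at least n. *)
Lemma agree_over_sum n :
  agree n (over_sum (q k) (d k) n (y i0 * q k) * qpoch_inf (y i0 * d k * q k) (q k))
    (qpoch_inf (- y i0 * q k) (q k)).
Proof.
have yq0 r : (y i0 * q k ^+ r.+1) 0%MM = 0.
  by rewrite exprS !fps_coef0M q_coef0 mul0r mulr0.
have step N : agree n (over_sum (q k) (d k) n (y i0 * q k)
       * \prod_(r < N) (1 - y i0 * d k * q k * q k ^+ r))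
    ((\prod_(r < N) (1 - - y i0 * q k * q k ^+ r))
      * over_sum (q k) (d k) n (y i0 * q k ^+ N.+1)).
  elim: N => [|N IHN]; first by rewrite !big_ord0 mulr1 mul1r expr1.
  rewrite !big_ord_recr mulrA /=.
  apply: agree_trans (agree_mul IHN (agree_refl _)) _.
  rewrite -2!(mulrA (\prod_(r < N) _)); apply: agree_mul; first exact: agree_refl.
  have -> : y i0 * d k * q k * q k ^+ N = y i0 * q k ^+ N.+1 * d k.
    by rewrite exprS; ring.
  have -> : 1 - - y i0 * q k * q k ^+ N = 1 + y i0 * q k ^+ N.+1.
    by rewrite exprS; ring.
  have -> : y i0 * q k ^+ N.+2 = y i0 * q k ^+ N.+1 * q k by rewrite !exprS; ring.
  exact: agree_over_sum_shift.
have qpochE (a : A) :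
    agree n (qpoch_inf a (q k)) (\prod_(r < n) (1 - a * q k ^+ r)).
  by move=> m lt_m; apply: qpoch_infE; rewrite ?q_coef0.
apply: agree_trans (agree_mul (agree_refl _) (qpochE _)) _.
apply: agree_trans (step n) _ => m lt_m; rewrite (qpochE _ _ lt_m).
rewrite -[in RHS](mulr1 (\prod_(r < n) _)).
apply: agree_mul lt_m; first exact: agree_refl.
rewrite /over_sum big_ord_recl big_ord0 expr0 qbin0 !mulr1; apply: agreeD0.
apply: agree_sum0 => a; rewrite lift0.
set c := qbin _ _ _; set D := \prod_(i < _) _; set v := _ ^+ a.+1.
have -> : c * v * D = q k ^+ n * q k ^+ 0
    * (c * y i0 * q k * (y i0 * q k ^+ n.+1) ^+ a * D).
  by rewrite /v exprS [X in _ * (_ * X * _) * _]exprS; ring.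
by apply: agree_high; rewrite ?addn0 // q_coef0.
Qed.

End Series.

Unset Implicit Arguments.

Theorem theorem1p22 (k : nat) (hk : (1 <= k)%N) :
  Sbar_series k =
    (\prod_(i < k) qpoch_inf (- y i * q k) (q k))
      / qpoch_inf (y (Ordinal hk) * d k * q k) (q k).
Proof.
apply: (canRL (mulrK (qpoch_inf_unit _))); apply/fpsP => m.
pose n := (mdeg m).+1; have lt_m : (mdeg m < n)%N by [].
have := agree_mul (@Sbar_seriesE k n) (agree_refl _) lt_m => ->.
have q_reg : GRing.lreg (q k) by apply: lreg_fpsX.
rewrite (sum_pattern_sums _ _ hk _ q_reg) [other_prod _ _ _ _ * _]mulrC mulrAC.
rewrite (bigD1 (Ordinal hk)) //.
apply: agree_mul lt_m.
  exact: agree_over_sum.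
apply: agree_prod => i _ m' lt_m'; rewrite (@qpoch_infE _ _ _ _ _ n) ?q_coef0 //.
by congr fps_coef; apply: eq_bigr => r _; rewrite exprS; ring.
Qed.
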